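(* For a compact space $X$, the following statements are equivalent: (1) There is a weak $c$-skeleton $(\{F_s:s\in\Gamma\},\psi)$ on $X$ which satisfies: $( ** )$ if $\langle s_n\rangle_{n<\omega}$ is an increasing sequence in $\Gamma$ with $s=\sup\{s_n:n<\omega\}$, then for each $x\in X$ and $U\in\mathcal N(\psi(s),x)$ there is $m<\omega$ such that $\overline{U\cap F_s}\cap V\cap F_{s_n}\ne\emptyset$ for every $n\ge m$ and every $V\in\mathcal N(\psi(s_n),x)$; and $( *** )$ for every $s,t\in\Gamma$ and $x\in X$, one can choose for each $V\in\mathcal N(\psi(s),r_t(x))$ some $U_V\in\mathcal N(\psi(t),r_s(x))$ such that $\emptyset\ne\overline{U_V}\cap F_t\cap F_s\subseteq\overline V\cap F_s$, and such that the family $\{\overline{U_V}\cap F_t\cap F_s:V\in\mathcal N(\psi(s),r_t(x))\}$ has the finite intersection property. Here $r_s:X\to F_s$ denotes the retraction determined by the weak $c$-skeleton, i.e. $r_s(x)$ is the unique point of $\bigcap_{V\in\mathcal N(\psi(s),x)}\overline{V\cap F_s}$. (2) There is a commutative $r$-skeleton on $X$.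
   Context: All spaces are Tychonoff; closures are in $X$. $[\tau]^{\le\omega}$ is the set of countable subsets of $\tau$. A retraction in $X$ is a continuous map $r:X\to X$ with $r\circ r=r$. A space is cosmic if it has a countable network. A partially ordered set $\Gamma$ is up-directed if any two elements have a common upper bound, and $\sigma$-complete if every increasing sequence in $\Gamma$ has a supremum in $\Gamma$. An $r$-skeleton on a space $X$ is a family $\{r_s:s\in\Gamma\}$ of retractions in $X$, indexed by an up-directed $\sigma$-complete partially ordered set $\Gamma$, such that: (i) $r_s(X)$ is cosmic for each $s\in\Gamma$; (ii) $r_s=r_s\circ r_t=r_t\circ r_s$ whenever $s\le t$; (iii) if $\langle s_n\rangle_{n<\omega}\subseteq\Gamma$ is increasing and $s=\sup\{s_n:n<\omega\}$, then $r_s(x)=\lim_{n\to\infty}r_{s_n}(x)$ for each $x\in X$; (iv) $x=\lim_{s\in\Gamma}r_s(x)$ for each $x\in X$. It is commutative if $r_s\circ r_t=r_t\circ r_s$ for all $s,t\in\Gamma$. Let $(X,\tau)$ be a space. If $\mathcal B$ is a base for a topology on $X$ and $x\in X$, put $\mathcal N(\mathcal B,x):=\{U\in\mathcal B:x\in U\}$. For a family $\{F_s:s\in\Gamma\}$ of closed subspaces of $X$, a function $\psi:\Gamma\to[\tau]^{\le\omega}$ is an assignment of bases for $\{F_s:s\in\Gamma\}$ if, for each $s\in\Gamma$, $\psi(s)$ is a base for a topology on $X$ (not necessarily $\tau$), $\psi(s)\upharpoonright_{F_s}:=\{U\cap F_s:U\in\psi(s)\}$ is a base for the subspace $F_s$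 of $(X,\tau)$, and $\emptyset\notin\psi(s)\upharpoonright_{F_s}$. A pair $(\{F_s:s\in\Gamma\},\psi)$, with $\Gamma$ an up-directed $\sigma$-complete partially ordered set, is a weak $c$-skeleton on $X$ if: (1) $\{F_s:s\in\Gamma\}$ is a family of closed cosmic subspaces of $X$ with $F_s\subseteq F_t$ whenever $s\le t$ and $\bigcup_{s\in\Gamma}F_s$ dense in $X$; (2) $\psi$ is an assignment of bases for $\{F_s:s\in\Gamma\}$; (3) for each $s\in\Gamma$, if $x\in X$ and $z\in\bigcap_{U\in\mathcal N(\psi(s),x)}\overline{U\cap F_s}$, then for each $V\in\mathcal N(\psi(s),z)$ there is $U\in\mathcal N(\psi(s),x)$ such that $\overline{U\cap F_s}\subseteq V$. For a weak $c$-skeleton on a compact space $X$ and each $s\in\Gamma$, $x\in X$, the set $\bigcap_{V\in\mathcal N(\psi(s),x)}\overline{V\cap F_s}$ is a singleton, and the map sending $x$ to its unique point is a retraction $r_s$ of $X$ onto $F_s$. *)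

(* Defs.v *)
From mathcomp Require Import all_boot all_order.
From mathcomp Require Import all_classical all_reals topology urysohn sequences.

Set Implicit Arguments.
Unset Strict Implicit.
Unset Printing Implicit Defensive.

Local Open Scope order_scope.
Local Open Scope classical_set_scope.

Definition tychonoff_space (X : topologicalType) : Prop :=
  hausdorff_space X /\ completely_regular_space X.

Definition network (X : topologicalType) (N : set (set X)) : Prop :=
  forall (U : set X) (x : X), open U -> U x -> exists2 M, N M & M x /\ M `<=` U.

Definition cosmic (X : topologicalType) : Prop :=
  exists2 N : set (set X), countable N & network N.

Definition retraction_in (X : topologicalType) (r : X -> X) : Prop :=
  continuous r /\ r \o r = r.

(* Nonemptiness is part of the usual notion of a directed set; without it the
   limit along an empty index set would be vacuous. *)
Definition up_directed d (G : porderType d) : Prop :=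
  [set: G] !=set0 /\ forall s t : G, exists u, s <= u /\ t <= u.

(* s is the supremum of the (weakly) increasing sequence u *)
Definition increasing_to d (G : porderType d) (u : nat -> G) (s : G) : Prop :=
  nondecreasing_seq u /\ supremums (range u) s.

Definition sigma_complete d (G : porderType d) : Prop :=
  forall u : nat -> G, nondecreasing_seq u -> exists s, supremums (range u) s.

(* Limits along this filter are limits of nets indexed by G. *)
Definition tails d (G : porderType d) : set_system G :=
  filter_from [set: G] (fun s => [set t | s <= t]).

Record r_skeleton (X : topologicalType) d (G : porderType d) (r : G -> X -> X) :
    Prop := {
  r_skeleton_up_directed : up_directed G;
  r_skeleton_sigma_complete : sigma_complete G;
  r_skeleton_retraction : forall s, retraction_in (r s);
  r_skeleton_cosmic : forall s, cosmic (set_type (range (r s)));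
  r_skeleton_le :
    forall s t, s <= t -> r s = r s \o r t /\ r s = r t \o r s;
  r_skeleton_sup : forall (u : nat -> G) s, increasing_to u s ->
    forall x, (fun n => r (u n) x) @ \oo --> r s x;
  r_skeleton_lim : forall x, (fun s => r s x) @ @tails d G --> x
}.

Definition commutative_family (X : Type) d (G : porderType d) (r : G -> X -> X) :
    Prop :=
  forall s t, r s \o r t = r t \o r s.

(* The topology is any topology on the underlying set of X. *)
Definition base_for_a_topology (X : choiceType) (B : set (set X)) : Prop :=
  exists T : Topological.axioms_ X, @basis (Topological.Pack T) B.

Definition nbase (X : Type) (B : set (set X)) (x : X) : set (set X) :=
  [set U | B U /\ U x].

(* The preimage of U under the inclusion of A is U `&` A as a subset of A. *)
Definition restrict_family (X : Type) (A : set X) (B : set (set X)) :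
    set (set (set_type A)) :=
  [set (set_val : set_type A -> X) @^-1` U | U in B].
Arguments restrict_family {X} A B.

Record assignment_of_bases (X : topologicalType) d (G : porderType d)
    (F : G -> set X) (psi : G -> set (set X)) : Prop := {
  bases_open : forall s, psi s `<=` open;
  bases_countable : forall s, countable (psi s);
  bases_topology : forall s, base_for_a_topology (psi s);
  bases_restrict : forall s, basis (restrict_family (F s) (psi s));
  bases_nonempty : forall s, ~ restrict_family (F s) (psi s) set0
}.

(* the intersection of the sets closure (V `&` F s), V in N(psi s, x) *)
Definition fiber (X : topologicalType) d (G : porderType d)
    (F : G -> set X) (psi : G -> set (set X)) (s : G) (x : X) : set X :=
  \bigcap_(V in nbase (psi s) x) closure (V `&` F s).

Record weak_c_skeleton (X : topologicalType) d (G : porderType d)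
    (F : G -> set X) (psi : G -> set (set X)) : Prop := {
  weak_c_up_directed : up_directed G;
  weak_c_sigma_complete : sigma_complete G;
  weak_c_closed : forall s, closed (F s);
  weak_c_cosmic : forall s, cosmic (set_type (F s));
  weak_c_le : forall s t, s <= t -> F s `<=` F t;
  weak_c_dense : dense (\bigcup_s F s);
  weak_c_bases : assignment_of_bases F psi;
  weak_c_fiber : forall s x z, fiber F psi s x z ->
    forall V, nbase (psi s) z V ->
    exists2 U, nbase (psi s) x U & closure (U `&` F s) `<=` V
}.

(* The retraction onto F s: for a weak c-skeleton on a compact space the fiber
   is a singleton, and the default value x of xget is not used. *)
Definition skeleton_retraction (X : topologicalType) d (G : porderType d)
    (F : G -> set X) (psi : G -> set (set X)) (s : G) (x : X) : X :=
  xget x [set z | fiber F psi s x = [set z]].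

Definition condition_two_stars (X : topologicalType) d (G : porderType d)
    (F : G -> set X) (psi : G -> set (set X)) : Prop :=
  forall (u : nat -> G) (s : G), increasing_to u s ->
  forall (x : X) (U : set X), nbase (psi s) x U ->
  exists m : nat, forall n : nat, (m <= n)%N ->
  forall V, nbase (psi (u n)) x V ->
    closure (U `&` F s) `&` V `&` F (u n) !=set0.

Definition condition_three_stars (X : topologicalType) d (G : porderType d)
    (F : G -> set X) (psi : G -> set (set X)) : Prop :=
  let r := skeleton_retraction F psi in
  forall (s t : G) (x : X), exists W : set X -> set X,
    (forall V, nbase (psi s) (r t x) V ->
      [/\ nbase (psi t) (r s x) (W V),
          closure (W V) `&` F t `&` F s !=set0 &
          closure (W V) `&` F t `&` F s `<=` closure V `&` F s]) /\
    finI (nbase (psi s) (r t x)) (fun V => closure (W V) `&` F t `&` F s).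

(* Main.v *)
Require Import Defs.
From mathcomp Require Import all_boot all_order finmap.
From mathcomp Require Import all_classical all_reals topology urysohn sequences.

(** Both structures live on the same index set, and the passage between them is
    the correspondence between a retraction [r] and the topology induced by
    [r].

    From a weak c-skeleton to retractions. The sets [V `&` F s], for [V] a
    basic neighbourhood of [x], are nonempty and directed downwards, so by
    compactness their closures meet in the fiber of [x]; the axiom on fibers
    makes the fiber a single point [r s x] and makes [r s] continuous. Under
    the condition with three stars a point [p] common to all the sets [closure
    (W V) `&` F t `&` F s] is [r s (r t x)], because these sets shrink inside
    [closure (V `&` F s)]. Symmetrically [r t (r s x)] lies in [F s], so it
    belongs to all of these sets as well, and equals [p]
    ([three_stars_commute]). The condition with two stars is what gives limits
    along increasing sequences ([two_stars_limit]). That [r s x] tends to [x]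
    is only clear for [x] in the dense union of the [F s]. It extends to every
    [x] by closing off ([retraction_lim]): if [r t x] left an open
    neighbourhood of [x] cofinally, one could build an increasing sequence [u]
    of such indices with supremum [s], and a point [y] of [F s], close to [x],
    with [r (u n) y = r (u n) x] for all [n]; in the limit [y = r s y = r s x],
    a contradiction.

    From a commutative r-skeleton to a weak c-skeleton. Take [F s] to be the
    range of [r s]. A compact cosmic space is second countable, so there is a
    countable family of nonempty open sets of the form [r s @^-1` O] which
    induces a base of [F s] ([saturated_base_exists]). These sets are a base of
    the initial topology of [r s], and the fiber of [x] is [r s x]. The two
    starred conditions are then witnessed by the points [r (u n) x] and, thanks
    to commutativity, by the point [r s (r t x) = r t (r s x)], which lies in
    both [F s] and [F t]. *)

Set Implicit Arguments.
Unset Strict Implicit.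
Unset Printing Implicit Defensive.

Local Open Scope classical_set_scope.

(** * Compactness and countable directedness *)

Lemma directed_closure_point (X : topologicalType) (I : Type) (D : set I)
    (f : I -> set X) :
  compact [set: X] -> D !=set0 ->
  (forall i j, D i -> D j -> exists2 k, D k & f k `<=` f i `&` f j) ->
  (forall i, D i -> f i !=set0) ->
  exists p, forall i, D i -> closure (f i) p.
Proof.
move=> cX D0 Df f0.
have FD : ProperFilter (filter_from D f).
  exact/filter_from_proper/f0/filter_from_filter.
have [p [_ clp]] := cX _ FD filterT.
by exists p => i Di A /clp; apply; exists i.
Qed.

Lemma compact_hausdorff_regular (X : topologicalType) :
  compact [set: X] -> hausdorff_space X -> regular_space X.
Proof. by move=> cX hX x; exact: (compact_regular hX cX filterT). Qed.

Lemma open_shrink (X : topologicalType) (x : X) (O : set X) :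
  regular_space X -> open O -> O x ->
  exists W, [/\ open W, W x & closure W `<=` O].
Proof.
move=> regX oO Ox; have [V Vx VO] := regX x O (open_nbhs_nbhs (conj oO Ox)).
exists V^°; split; [exact: open_interior | by [] |].
by apply: subset_trans VO; apply: closureS; exact: interior_subset.
Qed.

Lemma continuous_closure (X Y : topologicalType) (f : X -> Y) (A : set X)
    (B : set Y) :
  continuous f -> (forall x, A x -> B (f x)) ->
  forall x, closure A x -> closure B (f x).
Proof.
move=> cf AB x Ax C /cf /Ax [y [/AB Bfy Cfy]]; exists (f y); split => //.
Qed.

Lemma hausdorff_separate (X : topologicalType) (x y : X) :
  hausdorff_space X -> x <> y ->
  exists A B : set X, [/\ open A, open B, A x, B y & A `&` B = set0].
Proof.
rewrite open_hausdorff => hX /eqP /hX [[A B] /= [/set_mem Ax /set_mem By]].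
by case=> oA oB /eqP AB0; exists A, B.
Qed.

(** Joining the elements of the countable set one at a time gives an increasing
    sequence, whose supremum bounds them all. *)
Lemma countable_ubound d (G : porderType d) (A : set G) :
  up_directed G -> sigma_complete G -> countable A -> exists u, ubound A u.
Proof.
move=> [[g0 _] dirG] sigG cA.
case: (pfcard_geP cA) => [->|[f]]; first by exists g0 => x [].

have [join joinP] := choice (fun st : G * G => dirG st.1 st.2).
pose u n := iteri n (fun k s => join (s, f k)) g0.
have u_incr : nondecreasing_seq u.
  by apply/nondecreasing_seqP => n; exact: (joinP (u n, f n)).1.
have [s [us _]] := sigG u u_incr.
exists s => a Aa; have [n _ <-] := @surj _ _ _ _ f a Aa.
apply: (@Order.POrderTheory.le_trans _ _ (u n.+1)).
  exact: (joinP (u n, f n)).2.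
by apply: us; exists n.+1.
Qed.

Lemma nbase_neq0 (X : choiceType) (B : set (set X)) (x : X) :
  base_for_a_topology B -> nbase B x !=set0.
Proof.
by move=> [T [_ Bx]]; have [U [BU Ux] _] := Bx x _ filterT; exists U.
Qed.

Lemma nbase_directed (X : choiceType) (B : set (set X)) (x : X) (U V : set X) :
  base_for_a_topology B -> nbase B x U -> nbase B x V ->
  exists2 W, nbase B x W & W `<=` U `&` V.
Proof.
move=> [T [Bo Bx]] [BU Ux] [BV Vx].
have [|W [BW Wx] WUV] := Bx x (U `&` V); last by exists W.
by apply: open_nbhs_nbhs; split=> //; apply: openI; exact: Bo.
Qed.

(** * From a weak c-skeleton to a commutative r-skeleton *)

Section weak_c_to_r.
Context (X : topologicalType) (d : Order.disp_t) (G : porderType d).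
Context (F : G -> set X) (psi : G -> set (set X)).
Hypotheses (cX : compact [set: X]) (hX : hausdorff_space X).
Hypothesis wc : weak_c_skeleton F psi.

Let psiP := weak_c_bases wc.
Local Notation r := (skeleton_retraction F psi).

Lemma basis_trace_neq0 s U : psi s U -> U `&` F s !=set0.
Proof.
move=> sU; apply: contrapT => UF0; apply: (bases_nonempty psiP (s := s)).
exists U => //; rewrite -subset0 => y Uy.
by apply: UF0; exists (set_val y); split=> //; exact: set_valP.
Qed.

Lemma basis_trace_local s z O : F s z -> open O -> O z ->
  exists2 V, nbase (psi s) z V & V `&` F s `<=` O.
Proof.
move=> Fz oO Oz; pose z' : F s := exist _ z (mem_set Fz).
have [|A [[V sV <-] Vz VO]] :=
    (bases_restrict psiP s).2 z' (set_val @^-1` O).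
  by apply: open_nbhs_nbhs; split=> //; exists O.
exists V; first by split.
by move=> y [Vy Fy]; exact: (VO (exist _ y (mem_set Fy))).
Qed.

Lemma fiber_neq0 s x : fiber F psi s x !=set0.
Proof.
have [||||p pP] := @directed_closure_point X _ (nbase (psi s) x)
    (fun V => V `&` F s).
- exact: cX.
- exact: nbase_neq0 (bases_topology psiP _).
- move=> U V xU xV.
  have [W xW WUV] := nbase_directed (bases_topology psiP s) xU xV.
  by exists W => // y [/WUV[Uy Vy] Fy].
- by move=> V [sV _]; exact: basis_trace_neq0.
- by exists p.
Qed.

Lemma closure_trace_sub s V : closure (V `&` F s) `<=` F s.
Proof.
rewrite [X in _ `<=` X](closure_id _).1; last exact: weak_c_closed wc s.
by apply: closureS => y [].
Qed.

Lemma fiber_sub s x : fiber F psi s x `<=` F s.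
Proof.
have [V xV] := nbase_neq0 x (bases_topology psiP s).
by move=> z /(_ V xV) /closure_trace_sub.
Qed.

(** If [z] is in the fiber, the fiber axiom puts the whole fiber inside every
    basic neighbourhood of [z]; the traces of these neighbourhoods on [F s]
    separate [z] from any other point. *)
Lemma fiber_is_subset1 s x : is_subset1 (fiber F psi s x).
Proof.
move=> z w xz xw; apply: contrapT => zw.
have [A [B [oA oB Az Bw AB0]]] := hausdorff_separate hX zw.
have [V zV VA] := basis_trace_local (fiber_sub xz) oA Az.
have [U xU UV] := weak_c_fiber wc xz zV.
rewrite -[False]/(set0 w) -AB0; split=> //; apply: VA.
by split; [exact/UV/(xw _ xU) | exact: fiber_sub xw].
Qed.

Lemma fiber_retraction s x : fiber F psi s x = [set r s x].
Proof.
rewrite /skeleton_retraction; case: xgetP => [z _ //|].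
have [z xz] := fiber_neq0 s x => /(_ z) []; apply/seteqP; split=> [w xw|_ ->//].
exact: fiber_is_subset1 xw xz.
Qed.

Lemma retraction_fiber s x : fiber F psi s x (r s x).
Proof. by rewrite fiber_retraction. Qed.
Arguments retraction_fiber : clear implicits.

Lemma fiber_eq s x z : fiber F psi s x z -> z = r s x.
Proof. by rewrite fiber_retraction. Qed.

Lemma retraction_in_F s x : F s (r s x).
Proof. exact/fiber_sub/retraction_fiber. Qed.

Lemma retraction_id s x : F s x -> r s x = x.
Proof.
by move=> Fx; apply/esym/fiber_eq => V [_ Vx]; apply: subset_closure.
Qed.

(** The local form of the fiber axiom from which both the continuity of [r s]
    and the limits along sequences are read off. *)
Lemma retraction_local s x O : open O -> O (r s x) ->
  exists2 U, nbase (psi s) x U & closure (U `&` F s) `<=` O.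
Proof.
move=> oO Or; have [V rV VO] := basis_trace_local (retraction_in_F s x) oO Or.
have [U xU UV] := weak_c_fiber wc (retraction_fiber s x) rV.
exists U => // y Uy; apply: VO; split; first exact: UV.
exact: closure_trace_sub Uy.
Qed.

Lemma retraction_continuous s : continuous (r s).
Proof.
move=> x A; rewrite nbhsE => -[O [oO Or] OA].
have [U [sU Ux] UO] := retraction_local oO Or.
have : nbhs x U.
  by apply: open_nbhs_nbhs; split=> //; exact: bases_open psiP _ _ sU.
apply: filterS => y Uy; apply/OA/UO; exact: (retraction_fiber s y).
Qed.

(** In particular [closure V `&` F s] is [closure (V `&` F s)], since [r s] is
    the identity on [F s].  This is how the sets in the condition with three
    stars are compared with those that define the fibers. *)
Lemma retraction_closure s V y :
  psi s V -> closure V y -> closure (V `&` F s) (r s y).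
Proof.
move=> sV Vy; have clV : closed (closure (V `&` F s)) by exact: closed_closure.
rewrite [X in X _](closure_id _).1 //.
apply: continuous_closure Vy; first exact: retraction_continuous.
by move=> z Vz; exact: (retraction_fiber s z).
Qed.

Lemma range_retraction s : range (r s) = F s.
Proof.
apply/seteqP; split=> [_ [x _ <-]|x Fx]; first exact: retraction_in_F.
by exists x => //; exact: retraction_id.
Qed.

(** The point [p] obtained from [s], [t], [x] is [r s (r t x)] and lies in [F
    t]. Exchanging [s] and [t] shows that [r t (r s x)] lies in [F s], which is
    the premise needed to identify [r t (r s x)] with [p]. *)
Lemma three_stars_commute : condition_three_stars F psi ->
  commutative_family r.
Proof.
move=> ts.
have key s t x : exists p, [/\ F t p, p = r s (r t x) &
    F s (r t (r s x)) -> r t (r s x) = p].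
  have [W [WP Wfin]] := ts s t x.
  set C := fun V => closure (W V) `&` F t `&` F s in Wfin.
  have Ccl V : closure (C V) `<=` C V.
    have clC : closed (C V).
      apply: closedI; last exact: weak_c_closed wc s.
      by apply: closedI; [exact: closed_closure | exact: weak_c_closed wc t].
    by rewrite -(closure_id _).1.
  have Csub V y : nbase (psi s) (r t x) V -> C V y -> closure (V `&` F s) y.
    move=> xV; have [_ _ sub] := WP V xV => /sub [Vy Fy].
    by rewrite -(retraction_id Fy); apply: retraction_closure Vy; case: xV.
  have FF := finI_filter Wfin.
  have [p [_ clp]] := cX FF filterT.
  have Cp V : nbase (psi s) (r t x) V -> C V p.
    move=> xV; apply: Ccl => A /clp; apply; exists (C V) => //.
    exact: finI_from1.
  have [V0 xV0] := nbase_neq0 (r t x) (bases_topology psiP s).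
  have pE : p = r s (r t x) by apply: fiber_eq => V xV; exact/Csub/Cp.
  exists p; split=> //; first by have [[_]] := Cp _ xV0.
  (* [W V] is a basic neighbourhood of [r s x], so [r t (r s x)] lies in
     [closure (W V `&` F t)], hence in [C V] for every [V]. *)
  move=> Fts; rewrite pE; apply: fiber_eq => V xV; apply: Csub => //.
  have [xW _ _] := WP V xV; split=> //; split; last exact: retraction_in_F.
  have : closure (W V `&` F t) (r t (r s x)) by exact: retraction_fiber.
  by apply: closureS => y [].
move=> s t; apply/funext => x /=.
have [p [_ <- ->//]] := key s t x.
by have [q [Fq <- _]] := key t s x.
Qed.

Lemma retraction_le s t : (s <= t)%O -> r t \o r s = r s.
Proof.
move=> st; apply/funext => x; apply: retraction_id.
exact/(weak_c_le wc st)/retraction_in_F.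
Qed.

(** By compactness the sets that the condition declares nonempty have a common
    closure point; it lies in the fiber of [x] at [u n], so it is [r (u n) x],
    and it also lies in the small closed set [closure (U `&` F s)]. *)
Lemma two_stars_limit : condition_two_stars F psi ->
  forall u s, increasing_to u s -> forall x, r (u n) x @[n --> \oo] --> r s x.
Proof.
move=> ts u s us x A; rewrite nbhsE => -[O [oO Or] OA].
have [U xU UO] := retraction_local oO Or.
have [m mP] := ts u s us x U xU.
exists m => // n /= mn; apply/OA/UO.
have [||||p pP] := @directed_closure_point X _ (nbase (psi (u n)) x)
    (fun V => closure (U `&` F s) `&` V `&` F (u n)).
- exact: cX.
- exact: nbase_neq0 (bases_topology psiP _).
- move=> V V' xV xV'.
  have [W xW WVV] := nbase_directed (bases_topology psiP (u n)) xV xV'.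
  by exists W => // y [[Uy /WVV[Vy Vy'] Fy]].
- exact: mP.
have <- : p = r (u n) x.
  apply: fiber_eq => V xV; apply: closureS (pP V xV).
  by move=> y [[]].
have [V xV] := nbase_neq0 x (bases_topology psiP (u n)).
rewrite [X in X p](closure_id _).1; last exact: closed_closure.
by apply: closureS (pP V xV) => y [[]].
Qed.

(** The countably many basic neighbourhoods [V] of [x] at [s] each contain a
    point of [Y] in some [F t], since [x] is in [Y `&` V] and the union of the
    [F t] is dense. An upper bound of these [t] captures all these points at
    once, and compactness turns them into one point of [closure Y] with the
    same image as [x] under [r s]. *)
Lemma closing_off (Y : set X) (x : X) (s : G) : open Y -> Y x ->
  exists s1, (s <= s1)%O /\
    forall t, (s1 <= t)%O ->
      exists y, [/\ closure Y y, F t y & r s y = r s x].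
Proof.
move=> oY Yx.
have pick V : exists t, nbase (psi s) x V -> exists y, [/\ Y y, V y & F t y].
  have [xV|nxV] := pselect (nbase (psi s) x V); last by exists s.
  have [||y [[Yy Vy] [t _ Fy]]] := weak_c_dense wc (O := Y `&` V).
  - by exists x; split=> //; case: xV.
  - by apply: openI => //; case: xV => sV _; apply: (bases_open psiP) sV.
  - by exists t => _; exists y.
have [g gP] := choice pick.
have [u uP] : exists u, ubound (g @` nbase (psi s) x) u.
  apply: countable_ubound; first exact: weak_c_up_directed wc.
    exact: weak_c_sigma_complete wc.
  apply: sub_countable (card_image_le _ _) _.
  apply: sub_countable (bases_countable psiP s).
  by apply: subset_card_le => V [].
have [s1 [ss1 us1]] := (weak_c_up_directed wc).2 s u.
exists s1; split=> // t s1t.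
have [||||y yP] := @directed_closure_point X _ (nbase (psi s) x)
    (fun V => Y `&` V `&` F t).
- exact: cX.
- exact: nbase_neq0 (bases_topology psiP _).
- move=> V V' xV xV'.
  have [W xW WVV] := nbase_directed (bases_topology psiP s) xV xV'.
  by exists W => // y [[Yy /WVV[Vy Vy'] Fy]].
- move=> V xV; have [y [Yy Vy Fy]] := gP V xV; exists y; split=> //.
  apply: (weak_c_le wc _ Fy); apply: Order.POrderTheory.le_trans s1t.
  by apply: Order.POrderTheory.le_trans us1; apply: uP; exists V.
have [V xV] := nbase_neq0 x (bases_topology psiP s).
exists y; split.
- by apply: closureS (yP V xV) => z [[]].
- by apply: (@closure_trace_sub t V); apply: closureS (yP V xV) => z [[]].
apply: fiber_eq => U xU; apply: retraction_closure; first by case: xU.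
by apply: closureS (yP U xU) => z [[]].
Qed.

(** Closing off along a sequence. The sets [C n] of points near [x] and in [F
    s] that [r (u n)] does not distinguish from [x] are closed, nonempty and
    decreasing, so they share a point [y]. The limit along [u] gives [y = r s
    x]; but [y] is inside [O] while [r s x], a limit of points outside [O], is
    not. *)
Lemma retraction_lim :
  (forall s t, (s <= t)%O -> r s \o r t = r s) ->
  (forall u s, increasing_to u s ->
    forall x, r (u n) x @[n --> \oo] --> r s x) ->
  forall x, (fun s => r s x) @ @tails d G --> x.
Proof.
move=> rle rsup x A; rewrite nbhsE => -[O [oO Ox] OA].
suff [s sO] : exists s, forall t, (s <= t)%O -> O (r t x).
  by exists s => // t /= /sO /OA.
apply: contrapT => nO.
have cof s : exists2 t, (s <= t)%O & ~ O (r t x).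
  apply: contrapT => ns; apply: nO; exists s => t st; apply: contrapT => nOt.
  by apply: ns; exists t.
have [Y [oY Yx YO]] := open_shrink (compact_hausdorff_regular cX hX) oO Ox.
have next s : exists t, [/\ (s <= t)%O, ~ O (r t x) & forall u, (t <= u)%O ->
    exists y, [/\ closure Y y, F u y & r s y = r s x]].
  have [s1 [ss1 s1P]] := closing_off s oY Yx.
  have [t s1t nOt] := cof s1; exists t; split=> //.
    exact: Order.POrderTheory.le_trans ss1 s1t.
  by move=> u tu; apply: s1P; exact: Order.POrderTheory.le_trans tu.
have [g gP] := choice next.
have [[s0 _] _] := weak_c_up_directed wc.
pose u n := iter n.+1 g s0.
have u_incr : nondecreasing_seq u.
  by apply/nondecreasing_seqP => n; case: (gP (u n)).
have [s us] := weak_c_sigma_complete wc u_incr.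
have le_us n : (u n <= s)%O by apply: us.1; exists n.
pose C n := [set y | [/\ closure Y y, F s y & r (u n) y = r (u n) x]].
have clC n : closed (C n).
  have -> : C n = closure Y `&` F s `&` (r (u n) @^-1` [set r (u n) x]).
    by apply/seteqP; split=> [y []|y [[]]].
  apply: closedI.
    by apply: closedI; [exact: closed_closure | exact: weak_c_closed wc s].
  apply: (continuous_closedP _).1; first exact: retraction_continuous.
  exact: (accessible_closed_set1 (hausdorff_accessible hX)).
have C_decr m n : (m <= n)%N -> C n `<=` C m.
  move=> mn y [Yy Fy yx]; split=> //.
  by rewrite -(rle _ _ (u_incr _ _ mn)) /= yx.
have [||||y yP] := @directed_closure_point X nat setT C.
- exact: cX.
- by exists 0.
- move=> m n _ _; exists (maxn m n) => // y Cy.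
  by split; apply: C_decr Cy; rewrite ?leq_maxl ?leq_maxr.
- move=> n _; have [_ _ /(_ s (le_us n.+1))[y yP]] := gP (u n).
  by exists y.
have {}yP n : C n y by have := yP n Logic.I; rewrite -(closure_id _).1.
have [Yy Fy _] := yP 0%N.
have yE : y = r s x.
  rewrite -(retraction_id Fy).
  have ux := rsup u s (conj u_incr us) x.
  have uy := rsup u s (conj u_incr us) y.
  have E : (fun n => r (u n) y) = (fun n => r (u n) x).
    by apply/funext => n; case: (yP n).
  rewrite E in uy.
  apply: (@cvg_unique X hX ((fun n => r (u n) x) @ \oo)); [exact: uy|exact: ux].
have : (~` O) (r s x).
  have ux := rsup u s (conj u_incr us) x.
  apply: (@closed_cvg _ _ _ _ _ (~` O) (open_closedC oO) _ _ ux).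
  by apply: nearW => n; case: (gP (iter n g s0)).
by apply; rewrite -yE; exact: YO.
Qed.

End weak_c_to_r.

Lemma weak_c_skeleton_r_skeleton (X : topologicalType) (d : Order.disp_t)
    (G : porderType d) (F : G -> set X) (psi : G -> set (set X)) :
  compact [set: X] -> hausdorff_space X ->
  weak_c_skeleton F psi -> condition_two_stars F psi ->
  condition_three_stars F psi ->
  r_skeleton (skeleton_retraction F psi) /\
  commutative_family (skeleton_retraction F psi).
Proof.
move=> cX hX wc ts2 ts3; have comm := three_stars_commute cX hX wc ts3.
have rsup := two_stars_limit cX hX wc ts2.
have rle s t : (s <= t)%O ->
    skeleton_retraction F psi s \o skeleton_retraction F psi t =
    skeleton_retraction F psi s.
  by move=> st; rewrite comm (retraction_le cX hX wc st).
split=> //; split.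
- exact: weak_c_up_directed wc.
- exact: weak_c_sigma_complete wc.
- move=> s; split; first exact: retraction_continuous.
  by rewrite rle.
- by move=> s; rewrite range_retraction //; exact: weak_c_cosmic wc s.
- by move=> s t st; rewrite rle // (retraction_le cX hX wc st).
- exact: rsup.
- exact: retraction_lim.
Qed.


(** * Countable saturated bases of compact cosmic retracts *)

Lemma retraction_fixed (X : topologicalType) (r : X -> X) (y : X) :
  retraction_in r -> range r y -> r y = y.
Proof. by move=> [_ rr] [x _ <-]; rewrite -[in RHS]rr. Qed.

Lemma retraction_closed (X : topologicalType) (r : X -> X) :
  compact [set: X] -> hausdorff_space X -> retraction_in r -> closed (range r).
Proof.
move=> cX hX [cr _]; apply: (compact_closed hX).
by apply: continuous_compact => //; apply: continuous_subspaceT.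
Qed.

(** A countable base of the range of [r], carried by open subsets of the whole
    space that are unions of sets [r @^-1` [set y]]. The regularity of the range is
    built into the last field, where the closure of the trace, and not the
    trace alone, is required to be small: this is the form taken by the fiber
    axiom of a weak c-skeleton. *)
Record saturated_base (X : topologicalType) (r : X -> X) (B : set (set X)) :
    Prop := {
  saturated_countable : countable B;
  saturated_open : B `<=` open;
  saturated_neq0 : forall U, B U -> U !=set0;
  saturatedP : forall U, B U -> forall x, U (r x) <-> U x;
  saturated_local : forall x O, open O -> O (r x) ->
    exists2 U, nbase B x U & closure (U `&` range r) `<=` O
}.

(** For each pair of members of the network that some open set separates in the
    sense of [sep], one such open set is chosen. Disjoint neighbourhoods of
    [r x] and [r y] contain members of the network around these points, so
    countably many choices separate all pairs of points of the range. *)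
Lemma cosmic_separating (X : topologicalType) (r : X -> X) :
  hausdorff_space X -> cosmic (set_type (range r)) ->
  exists S : set (set X), [/\ countable S, S `<=` open &
    forall x y, r x <> r y -> exists O, [/\ S O, O (r x) & ~ closure O (r y)]].
Proof.
move=> hX [N cN netN].
pose rho x : range r := exist _ (r x) (mem_set (imageT r x)).
pose sep (p : set (range r) * set (range r)) (O : set X) := [/\ open O,
  forall x, p.1 (rho x) -> O (r x) &
  forall y, p.2 (rho y) -> ~ closure O (r y)].
have pick p : exists O, (exists O', sep p O') -> sep p O.
  by have [[O sO]|nO] := pselect (exists O', sep p O'); [exists O|exists setT].
have [g gP] := choice pick.
exists (open `&` (g @` (N `*` N))); split.
- apply: sub_countable (subset_card_le (@subIsetr _ _ _)) _.
  exact/(sub_countable (card_image_le _ _))/countableX.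
- by move=> O [].
move=> x y /(hausdorff_separate hX)[A [B [oA oB Ax By AB0]]].
have net U z : open U -> U (r z) ->
    exists M, [/\ N M, M (rho z) & forall w, M (rho w) -> U (r w)].
  move=> oU Uz; have [||M NM [Mz MU]] := netN (set_val @^-1` U) (rho z).
  - by exists U.
  - exact: Uz.
  - by exists M; split=> // w /MU.
have [M [NM Mx MA]] := net A x oA Ax.
have [M' [NM' My MB]] := net B y oB By.
have [] : sep (M, M') (g (M, M')).
  apply: gP; exists A; split=> //= w /MB Bw clA.
  have [z] := clA B (open_nbhs_nbhs (conj oB Bw)).
  by rewrite AB0.
move=> /= og gM gM'; exists (g (M, M')); split; [|exact: gM|exact: gM'].
by split=> //; exists (M, M').
Qed.

(** A coarser Hausdorff topology on a compact space is the original one: the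
    finite intersections of the separating sets induce a base of the range. If
    none of those around [r x] were small enough, compactness would give a
    point [p] of the range outside [O] which no separating set distinguishes
    from [r x]. *)
Lemma saturated_base_exists (X : topologicalType) (r : X -> X) :
  compact [set: X] -> hausdorff_space X -> retraction_in r ->
  cosmic (set_type (range r)) -> exists B, saturated_base r B.
Proof.
move=> cX hX rr cosr; have [S [cS oS sepS]] := cosmic_separating hX cosr.
pose D := finI_from S id.
have oD : D `<=` open.
  move=> _ [D' DS <-]; rewrite bigcap_fset big_seq.
  by apply: big_ind => [|A B|A /DS /set_mem/oS //]; [exact: openT|exact: openI].
have DT : D setT.
  by exists fset0; rewrite ?set_fset0 ?bigcap_set0.
exists ((fun O => r @^-1` O) @` D `&` [set U | U !=set0]); split.
- apply: sub_countable (subset_card_le (@subIsetl _ _ _)) _.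
  exact/(sub_countable (card_image_le _ _))/finI_from_countable.
- move=> _ [[O /oD oO <-] _]; apply: open_comp => // y _; exact: rr.1.
- by move=> U [].
- by move=> _ [[O _ <-] _] x; rewrite /= -[r (r x)]/((r \o r) x) rr.2.
move=> x O oO Ox; apply: contrapT => nU.
have bad V : D V -> V (r x) ->
    (closure (r @^-1` V `&` range r) `&` ~` O) !=set0.
  move=> DV Vx; apply: contrapT => V0; apply: nU; exists (r @^-1` V).
    by split=> //; split; [exists V|exists x].
  by move=> y Vy; apply: contrapT => nOy; apply: V0; exists y.
have [||||p pP] := @directed_closure_point X _ [set V | D V /\ V (r x)]
  (fun V => closure (r @^-1` V `&` range r) `&` ~` O).
- exact: cX.
- by exists setT.
- move=> V V' [DV Vx] [DV' Vx']; exists (V `&` V').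
    by split=> //; exact: finI_fromI.
  by move=> y [cy nOy]; split; split=> //; apply: closureS cy => z [[]].
- by move=> V [DV Vx]; exact: bad.
have {}pP V : D V -> V (r x) -> closure V p /\ (range r `&` ~` O) p.
  move=> DV Vx; have := pP V (conj DV Vx).
  rewrite -(closure_id _).1; last first.
    by apply: closedI; [exact: closed_closure|exact: open_closedC].
  move=> [cp nOp]; split; [|split=> //].
    by apply: closureS cp => z [+ /(retraction_fixed rr)] => /[swap] /= ->.
  rewrite [range r](closure_id _).1; last exact: retraction_closed.
  by apply: closureS cp => z [].
have [_ [rp nOp]] : closure setT p /\ (range r `&` ~` O) p.
  exact: pP.
have [|V [SV Vx]] := sepS x p.
  by rewrite (retraction_fixed rr rp) => xp; apply: nOp; rewrite -xp.
rewrite (retraction_fixed rr rp); apply.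
by have [] := pP V (finI_from1 id SV) Vx.
Qed.

(** * From a commutative r-skeleton to a weak c-skeleton *)

Section r_to_weak_c.
Context (X : topologicalType) (d : Order.disp_t) (G : porderType d).
Context (r : G -> X -> X) (psi : G -> set (set X)).
Hypotheses (cX : compact [set: X]) (hX : hausdorff_space X).
Hypothesis rs : r_skeleton r.
Hypothesis psiP : forall s, saturated_base (r s) (psi s).

Let F s := range (r s).
Let rP s := r_skeleton_retraction rs s.

Lemma saturated_bases : assignment_of_bases F psi.
Proof.
split=> s.
- exact: saturated_open (psiP s).
- exact: saturated_countable (psiP s).
- exists (Topological.class (initial_topology (r s))); split.
    move=> U sU; exists U; first exact: saturated_open (psiP s) _ sU.
    by apply/seteqP; split=> x /(saturatedP (psiP s) sU).
  move=> x A /= [_ [[O oO <-] Ox] OA].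
  have [U [sU Ux] UO] := saturated_local (psiP s) oO Ox.
  exists U => //= y Uy; apply/OA/UO/subset_closure; split; last exact: imageT.
  exact/(saturatedP (psiP s) sU).
- split=> [_ [U sU <-]|x A].
    by exists U => //; exact: saturated_open (psiP s) _ sU.
  move=> [_ [[O oO <-] Ox] OA].
  have rx := retraction_fixed (rP s) (set_valP x).
  have [|U [sU Ux] UO] := saturated_local (psiP s) (x := set_val x) oO.
    by rewrite rx.
  exists (set_val @^-1` U); first by split=> //; exists U.
  move=> y Uy; apply/OA/UO/subset_closure; split=> //; exact: set_valP.
move=> [U sU U0]; have [x Ux] := saturated_neq0 (psiP s) sU.
pose y : F s := exist _ (r s x) (mem_set (imageT (r s) x)).
rewrite -[False]/(set0 y) -U0 /=; exact/(saturatedP (psiP s) sU).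
Qed.

Lemma saturated_fiber s x : fiber F psi s x = [set r s x].
Proof.
apply/seteqP; split=> [z xz|_ -> V [sV Vx]]; last first.
  apply: subset_closure; split; last exact: imageT.
  exact/(saturatedP (psiP s) sV).
apply: contrapT => zx.
have [A [B [oA oB Az Bx AB0]]] := hausdorff_separate hX zx.
have [U xU UB] := saturated_local (psiP s) oB Bx.
by rewrite -[False]/(set0 z) -AB0; split=> //; exact/UB/(xz _ xU).
Qed.

Lemma saturated_retraction : skeleton_retraction F psi = r.
Proof.
apply/funext => s; apply/funext => x.
apply: xget_unique => [|y]; first exact: saturated_fiber.
by rewrite /= saturated_fiber => /seteqP[/(_ _ erefl)].
Qed.

Lemma saturated_weak_c : weak_c_skeleton F psi.
Proof.
split.
- exact: r_skeleton_up_directed rs.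
- exact: r_skeleton_sigma_complete rs.
- by move=> s; exact: retraction_closed.
- exact: r_skeleton_cosmic rs.
- by move=> s t st _ [x _ <-]; rewrite (r_skeleton_le rs st).2; exact: imageT.
- move=> O [x Ox] oO.
  have [s _ sO] := r_skeleton_lim rs (open_nbhs_nbhs (conj oO Ox)).
  exists (r s x); split; first exact: (sO s (Order.POrderTheory.lexx s)).
  by exists s => //; exact: imageT.
- exact: saturated_bases.
move=> s x z; rewrite saturated_fiber => -> V [sV Vr].
by apply: (saturated_local (psiP s)) => //; exact: saturated_open (psiP s) _ sV.
Qed.

(** The point [r (u n) x] lies in every basic neighbourhood of [x] at [u n],
    and it is eventually in [U] because it converges to [r s x]. *)
Lemma saturated_two_stars : condition_two_stars F psi.
Proof.
move=> u s us x U [sU Ux].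
have [|m _ mP] := r_skeleton_sup rs us (x := x) (t := U).
  apply: open_nbhs_nbhs; split; first exact: saturated_open (psiP s) _ sU.
  exact/(saturatedP (psiP s) sU).
exists m => n mn V [sV Vx]; exists (r (u n) x); split; last exact: imageT.
split; last exact/(saturatedP (psiP (u n)) sV).
apply: subset_closure; split; first exact: mP.
have un : (u n <= s)%O by apply: us.2.1; exists n.
by rewrite (r_skeleton_le rs un).2; exact: imageT.
Qed.

(** Commutativity puts [p = r t (r s x) = r s (r t x)] in [F s `&` F t]. A
    basic [V] at [s] around [r t x] is saturated, so it contains [p], and one
    may take for [W V] any basic set at [t] around [p] with [closure (W V `&` F
    t)] inside [V]: this closure is [closure (W V) `&` F t]. All the sets
    obtained contain [p], which gives the finite intersection property. *)
Lemma saturated_three_stars : commutative_family r ->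
  condition_three_stars F psi.
Proof.
rewrite /condition_three_stars saturated_retraction => comm /= s t x.
have commx : r t (r s x) = r s (r t x) by exact: (congr1 (@^~ x) (comm t s)).
have pick V : exists W, nbase (psi s) (r t x) V ->
    nbase (psi t) (r s x) W /\ closure (W `&` F t) `<=` V.
  have [[sV Vx]|nV] := pselect (nbase (psi s) (r t x) V); last by exists setT.
  have [||W xW WV] := saturated_local (psiP t) (x := r s x) (O := V).
  - exact: saturated_open (psiP s) _ sV.
  - by rewrite commx; exact/(saturatedP (psiP s) sV).
  by exists W.
have [W WP] := choice pick.
have Wp V : nbase (psi s) (r t x) V ->
    (closure (W V) `&` F t `&` F s) (r t (r s x)).
  move=> /WP[[tW Wx] _]; split; last by rewrite commx; exact: imageT.
  split; last exact: imageT.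
  exact/subset_closure/(saturatedP (psiP t) tW).
exists W; split=> [V xV|D DV]; last first.
  by exists (r t (r s x)) => V /DV/set_mem/Wp.
have [[tW Wx] WV] := WP V xV; split=> //.
  by exists (r t (r s x)); exact: Wp.
move=> y [[Wy Fty] Fsy]; split=> //; apply/subset_closure/WV.
rewrite -(retraction_fixed (rP t) Fty).
apply: continuous_closure Wy => [|z Wz]; first exact: (rP t).1.
by split; [exact/(saturatedP (psiP t) tW)|exact: imageT].
Qed.

End r_to_weak_c.

Theorem theorem6p7 (X : topologicalType)
    (tychonoff_X : tychonoff_space X) (compact_X : compact [set: X]) :
  (exists (d : Order.disp_t) (G : porderType d)
          (F : G -> set X) (psi : G -> set (set X)),
    [/\ weak_c_skeleton F psi,
        condition_two_stars F psi &
        condition_three_stars F psi])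
  <->
  (exists (d : Order.disp_t) (G : porderType d) (r : G -> X -> X),
    r_skeleton r /\ commutative_family r).
Proof.
have hX := tychonoff_X.1.
split=> [[d [G [F [psi [wc ts2 ts3]]]]]|[d [G [r [rs comm]]]]].
  exists d, G, (skeleton_retraction F psi).
  exact: weak_c_skeleton_r_skeleton.
have [psi psiP] := choice (fun s => saturated_base_exists compact_X hX
  (r_skeleton_retraction rs s) (r_skeleton_cosmic rs s)).
exists d, G, (fun s => range (r s)), psi; split.
- exact: saturated_weak_c.
- exact: saturated_two_stars.
- exact: saturated_three_stars.
Qed.
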